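(* Given $\epsilon,\beta\in(0,1)$, for any $M>0$ there exist instances of the mixed-integer convex chance constrained program $$\min_{(\mathbf{x},\mathbf{y})\in\mathbf{V}} c^\top\mathbf{x}\quad\text{subject to}\quad \mathbb{P}[f(\mathbf{x},\mathbf{y},\mathbf{w})\le 0]\ge 1-\epsilon,$$ partitions $\mathbf{P}$ of the row index set $\mathcal{J}=\{1,\dots,r\}$ of $f$ with parameters $\boldsymbol{\epsilon},\boldsymbol{\beta}\in(0,1)^{|\mathbf{P}|}$ satisfying $\sum_i\epsilon_i\le\epsilon$ and $\sum_i\beta_i\le\beta$, and computational cost metrics $\nu$ such that $$\frac{N(\{\mathcal{J}\},\epsilon,\beta)}{N(\mathbf{P},\boldsymbol{\epsilon},\boldsymbol{\beta})}\ge M.$$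
   Context: Setting of an instance. $\mathbf{V}\subseteq\mathbb{R}^n\times\{0,1\}^b$ is compact and convex for fixed $\mathbf{y}$; $c\in\mathbb{R}^n$; $\mathbf{w}$ is an uncertain parameter defined over a probability space $(\mathbf{W},\mathcal{F},\mathbb{P})$; $f:\mathbb{R}^n\times\{0,1\}^b\times\mathbf{W}\to\mathbb{R}^r$ has components $f_1,\dots,f_r$ and is convex in $\mathbf{x}$ for all $\mathbf{w}\in\mathbf{W}$ and all $\mathbf{y}\in\mathbf{Y}:=\{\mathbf{y}\in\{0,1\}^b:\exists\mathbf{x},\ (\mathbf{x},\mathbf{y})\in\mathbf{V}\}$. The case $b=0$ (no binary variables) is allowed. Support rank. Let $\mathcal{L}$ be the set of all linear subspaces of $\mathbb{R}^n$. For $g:\mathbb{R}^n\times\{0,1\}^b\times\mathbf{W}\to\mathbb{R}$ let $F_g(\mathbf{x},\mathbf{y},\mathbf{w}):=\{\xi\in\mathbb{R}^n: g(\mathbf{x}+\xi,\mathbf{y},\mathbf{w})=g(\mathbf{x},\mathbf{y},\mathbf{w})\}$ and $\mathcal{L}_g:=\bigcap_{(\mathbf{x},\mathbf{y},\mathbf{w})\in\mathbf{V}\times\mathbf{W}}\{L\in\mathcal{L}: L\subseteq F_g(\mathbf{x},\mathbf{y},\mathbf{w})\}$. For $\mathcal{A}\subseteq\mathcal{J}$, $L_{\mathcal{A}}$ is the maximal (with respect to inclusion) element of $\mathcal{L}_g$ with $g=\max_{j\in\mathcal{A}}f_j$, and $\rho(\mathcal{A}):=n-\dim(L_{\mathcal{A}})$.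 Computational cost metric: a set function $\nu:2^{\mathcal{J}}\to\mathbb{R}_{\ge0}$ that is monotone ($\nu(\mathcal{A})\le\nu(\mathcal{B})$ for $\mathcal{A}\subseteq\mathcal{B}$), modular ($\nu(\mathcal{A}\cup\{j\})-\nu(\mathcal{A})=\nu(\mathcal{B}\cup\{j\})-\nu(\mathcal{B})$ for $\mathcal{A}\subseteq\mathcal{B}\subset\mathcal{J}$, $j\in\mathcal{J}\setminus\mathcal{B}$), and satisfies $\nu(\{j\})>0$ for all $j\in\mathcal{J}$. Computational cost: for a partition $\mathbf{P}=\{\mathcal{P}_i\}_{i=1}^P$ of $\mathcal{J}$ (nonempty parts), $$N(\mathbf{P},\boldsymbol{\epsilon},\boldsymbol{\beta}):=\frac{e}{e-1}\sum_{i=1}^P\frac{1}{\epsilon_i}\Big(\ln\Big(\frac{2^b}{\beta_i}\Big)+\rho(\mathcal{P}_i)-1\Big)\nu(\mathcal{P}_i).$$ $\{\mathcal{J}\}$ is the trivial partition with a single part. *)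

(* Defs.v *)
From HB Require Import structures.
From mathcomp Require Import all_boot all_order all_algebra.
From mathcomp Require Import all_classical all_reals all_analysis.

Set Implicit Arguments.
Unset Strict Implicit.
Unset Printing Implicit Defensive.

Import Order.TTheory GRing.Theory Num.Theory.
Import numFieldNormedType.Exports.

Local Open Scope classical_set_scope.
Local Open Scope ring_scope.

(** A mixed-integer convex chance constrained program at violation level [eps]:

      minimize c^T x over (x, y) in V  subject to  P[f(x, y, w) <= 0] >= 1 - eps

    [{0,1}^b] is ['rV[bool]_b], whose topology is discrete, so [ccp_V_compact]
    is compactness in the product [R^n * {0,1}^b].  [ccp_f_measurable] is what
    makes the chance constraint meaningful, and [ccp_r_gt0] says that the row
    index set ['I_r] is nonempty. *)
Record ccp (R : realType) (eps : R) := Ccp {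
  ccp_n : nat;
  ccp_b : nat;
  ccp_r : nat;
  ccp_r_gt0 : (0 < ccp_r)%N;
  ccp_V : set ('rV[R]_ccp_n * 'rV[bool]_ccp_b);
  ccp_V_compact : compact ccp_V;
  ccp_V_convex : forall y, convex_set [set x | ccp_V (x, y)];
  ccp_c : 'rV[R]_ccp_n;
  ccp_disp : measure_display;
  ccp_W : measurableType ccp_disp;
  ccp_P : probability ccp_W R;
  ccp_f : 'rV[R]_ccp_n -> 'rV[bool]_ccp_b -> ccp_W -> 'rV[R]_ccp_r;
  ccp_f_measurable : forall x y j,
    measurable_fun [set: ccp_W] (fun w => ccp_f x y w 0 j);
  ccp_f_convex : forall y w j, (exists x, ccp_V (x, y)) ->
    convex_function [set: 'rV[R]_ccp_n] (fun x => ccp_f x y w 0 j)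
}.

Arguments ccp_V [R eps] c _.
Arguments ccp_f [R eps] c _ _ _.

Section program.
Variables (R : realType) (eps : R) (I : ccp eps).

Definition objective (p : 'rV[R]_(ccp_n I) * 'rV[bool]_(ccp_b I)) : R :=
  \sum_i ccp_c I 0 i * p.1 0 i.

Definition feasible : set ('rV[R]_(ccp_n I) * 'rV[bool]_(ccp_b I)) :=
  [set p | ccp_V I p /\
    ((1 - eps)%:E <= ccp_P I [set w | forall j, ccp_f I p.1 p.2 w 0%R j <= 0]%R)%E].

End program.

Section support_rank.
Variables (R : realType) (eps : R) (I : ccp eps).

Local Notation n := (ccp_n I).
Local Notation b := (ccp_b I).
Local Notation W := (ccp_W I).

Definition invariance_set (g : 'rV[R]_n -> 'rV[bool]_b -> W -> R) x y w :
    set 'rV[R]_n :=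
  [set xi | g (x + xi) y w = g x y w].

Definition invariance_spaces (g : 'rV[R]_n -> 'rV[bool]_b -> W -> R) :
    set {vspace 'rV[R]_n} :=
  \bigcap_(p in ccp_V I `*` [set: W])
    [set L | [set` L] `<=` invariance_set g p.1.1 p.1.2 p.2].

Definition maximal_subspace (S : set {vspace 'rV[R]_n}) (L : {vspace 'rV[R]_n}) :=
  S L /\ forall L', S L' -> (L <= L')%VS -> L' = L.

(** [max_(j in A) f_j]; the value for [A = set0] is a junk value. *)
Definition max_rows (A : {set 'I_(ccp_r I)}) x y (w : W) : R :=
  if [pick j in A] is Some j0
  then \big[Order.max/ccp_f I x y w 0 j0]_(j in A) ccp_f I x y w 0 j
  else 0.

(** The family contains the zero subspace, so by dimension a maximal element
    exists.  It is unique: a finite convex function that is constant along a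
    line is constant along every parallel line, so the family attached to a
    maximum of convex functions is closed under sums of subspaces. *)
Definition support_space (A : {set 'I_(ccp_r I)}) : {vspace 'rV[R]_n} :=
  xget 0%VS (maximal_subspace (invariance_spaces (max_rows A))).

Definition support_rank (A : {set 'I_(ccp_r I)}) : nat :=
  (n - \dim (support_space A))%N.

End support_rank.

Section cost.
Variable R : realType.

Definition cost_metric (J : finType) (nu : {set J} -> R) : Prop :=
  [/\ forall A, 0 <= nu A,
      forall A B : {set J}, A \subset B -> nu A <= nu B,
      forall (A B : {set J}) j,
        A \subset B -> B \proper [set: J]%SET -> j \notin B ->
        nu (j |: A)%SET - nu A = nu (j |: B)%SET - nu B
    & forall j, 0 < nu [set j]%SET].

(** A partition is an unordered set of parts; the parameters [e] and [d] (the
    violation levels and the confidence levels) are indexed by the parts, and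
    only their values at elements of [PP] matter. *)
Definition comp_cost (eps : R) (I : ccp eps)
    (nu : {set 'I_(ccp_r I)} -> R) (PP : {set {set 'I_(ccp_r I)}})
    (e d : {set 'I_(ccp_r I)} -> R) : R :=
  expR 1 / (expR 1 - 1) *
  \sum_(A in PP)
    (e A)^-1 * (ln (2 ^+ ccp_b I / d A) + (support_rank A)%:R - 1) * nu A.

End cost.

(* Main.v *)
Require Import Defs.
From mathcomp Require Import all_boot all_order all_algebra.
From mathcomp Require Import all_classical all_reals all_analysis.
From mathcomp Require Import lra.

Import Order.TTheory GRing.Theory Num.Theory.
Import numFieldNormedType.Exports.
Local Open Scope ring_scope.

(** A single sampling bound for all rows pays the support rank of the hardest
    row for every row, including those that are costly to evaluate.  Splitting
    the rows lets a costly row of small support rank be sampled at its own rate.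

    The ratio is made large on [R^(k+1)] with the two rows [x_0] and [`|x|].
    The first one, of support rank 1 ([support_rank_coord]), has cost 1.  The
    second one has full support rank [k + 1]; it dominates the first, so the
    maximum of both rows also has rank [k + 1] ([support_rank_norm]).  Its cost
    is only [1 / (k + 1)], so its own term is bounded in [k].  Up to constants,
    the trivial partition costs [k / eps], while the partition into single rows,
    at levels [eps / 2] and [beta / 2], costs [1 / eps]; hence the ratio grows
    linearly in [k] ([cost_ratio_ge]).

    The cost sees the program only through its ranks and the number of binary
    variables, so the instance can be deterministic (a Dirac measure on a point)
    with the origin as its domain and no binary variables.  The origin already
    separates directions: both rows vanish there, so a direction leaves a row
    unchanged exactly when the row vanishes at that direction. *)

Lemma max_rows_dominant (R : realType) (eps : R) (I : ccp eps)
    (A : {set 'I_(ccp_r I)}) (i : 'I_(ccp_r I)) x y w :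
  i \in A -> (forall j, j \in A -> ccp_f I x y w 0 j <= ccp_f I x y w 0 i) ->
  max_rows A x y w = ccp_f I x y w 0 i.
Proof.
move=> iA fi; rewrite /max_rows; case: pickP => [j0 j0A|/(_ i)]; last first.
  by rewrite iA.
by apply/le_anti; rewrite bigmax_le ?fi//= le_bigmax_cond.
Qed.

(** The support space is a chosen maximal element, hence determined as soon as
    the family has a greatest one; the families below are principal ideals of
    subspaces. *)
Lemma support_spaceE (R : realType) (eps : R) (I : ccp eps)
    (A : {set 'I_(ccp_r I)}) (H : {vspace 'rV[R]_(ccp_n I)}) :
  (forall L, invariance_spaces (max_rows A) L <-> (L <= H)%VS) ->
  support_space A = H.
Proof.
move=> LH; apply: xget_unique.
  split; first by apply/LH.
  by move=> L /LH LleH HleL; apply/subv_anti/andP.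
move=> L [/LH LleH maxL]; apply/esym/maxL => //.
exact/LH.
Qed.

Lemma entry_le_norm (R : realType) (m n : nat) (x : 'M[R]_(m.+1, n.+1)) i j :
  x i j <= `|x|.
Proof.
rewrite (le_trans (ler_norm _))// [leRHS]mx_normrE.
exact: (le_bigmax _ (fun ij => `|x ij.1 ij.2|) (i, j)).
Qed.

(** The linear form [x |-> x 0 0]; with values in 1 x 1 matrices it is the
    column map, whose linearity is canonical. *)
Definition coord0 (R : realType) (n : nat) : 'Hom('rV[R]_n.+1, 'cV[R]_1) :=
  linfun (col 0).

Lemma coord0_eq0 (R : realType) (n : nat) (x : 'rV[R]_n.+1) :
  (coord0 R n x == 0) = (x 0 0 == 0).
Proof.
rewrite lfunE/=; apply/eqP/eqP => [/matrixP/(_ 0 0)|x0]; first by rewrite !mxE.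
by apply/matrixP => i j; rewrite !mxE !ord1.
Qed.

Lemma dim_lker_coord0 (R : realType) (n : nat) : \dim (lker (coord0 R n)) = n.
Proof.
have := limg_ker_dim (coord0 R n) fullv.
have -> : limg (coord0 R n) = fullv.
  apply/vspaceP => v; rewrite memvf; apply/memv_imgP.
  exists (const_mx (v 0 0)); first exact: memvf.
  by rewrite lfunE; apply/matrixP => i j; rewrite !mxE !ord1.
by rewrite capfv !dimvf !dim_matrix !mul1r addn1 => -[].
Qed.

Section two_rows.
Variables (R : realType) (eps : R) (n : nat).

Let V : set ('rV[R]_n.+1 * 'rV[bool]_0) := [set (0, 0)]%classic.

Definition rows (x : 'rV[R]_n.+1) (_ : 'rV[bool]_0) (_ : unit) : 'rV[R]_2 :=
  \row_j (if j == 0 then x 0 0 else `|x|).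

Let V_compact : compact V.
Proof. exact: compact_set1. Qed.

Let V_convex y : convex_set [set x | V (x, y)]%classic.
Proof.
move=> x x' t; rewrite !inE => -[-> ->] [->].
by congr (_, _); exact: (convmm (s := convex_lmodType 'rV[R]_n.+1)).
Qed.

Let rows_measurable x y j :
  measurable_fun [set: unit] (fun w => rows x y w 0 j).
Proof. exact: measurable_cst. Qed.

Let rows_convex y w j : (exists x, V (x, y)) ->
  convex_function [set: 'rV[R]_n.+1]%classic (fun x => rows x y w 0 j).
Proof.
move=> _ t x x' _ _; rewrite !mxE.
case: ifP => _; first exact: lexx.
by rewrite (le_trans (ler_normD _ _))// !normrZ !ger0_norm// unstable.onem_ge0.
Qed.

Definition two_row_ccp : ccp eps :=
  @Ccp R eps n.+1 0 2 isT V V_compact V_convex 0 _ unit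
    (dirac tt) rows rows_measurable rows_convex.

(** The norm row dominates the coordinate row, so it is the maximum over every
    [A] containing it; at the origin only the zero direction keeps the norm. *)
Lemma support_rank_norm (A : {set 'I_2}) :
  1 \in A -> support_rank (I := two_row_ccp) A = n.+1.
Proof.
move=> A1; have maxA x y w : max_rows (I := two_row_ccp) A x y w = `|x|.
  rewrite (max_rows_dominant _ _ two_row_ccp A 1)//= ?mxE//.
  by move=> j _; rewrite !mxE/=; case: ifP => // _; exact: entry_le_norm.
rewrite /support_rank (support_spaceE _ _ two_row_ccp _ 0%VS);
  first by rewrite dimv0 subn0.
move=> L.
rewrite subv0; split => [LV|/eqP ->]; last first.
  move=> [[x y] w] _ /= xi; rewrite /= memv0 => /eqP ->.
  by rewrite /invariance_set /= addr0.
apply/eqP/vspaceP => v; rewrite memv0.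
apply/idP/eqP => [vL|->]; last exact: mem0v.
have := LV ((0, 0), tt) (conj erefl I) v vL.
by rewrite /invariance_set /= !maxA add0r normr0 => /normr0_eq0.
Qed.

(** A linear row is unchanged exactly along its kernel, a hyperplane. *)
Lemma support_rank_coord : support_rank (I := two_row_ccp) [set 0]%SET = 1%N.
Proof.
have maxA x y w : max_rows (I := two_row_ccp) [set 0]%SET x y w = x 0 0.
  rewrite (max_rows_dominant _ _ two_row_ccp _ 0)/= ?mxE ?inE//.
  by move=> j; rewrite inE => /eqP ->; rewrite mxE.
rewrite /support_rank (support_spaceE _ _ two_row_ccp _ (lker (coord0 R n))).
  by rewrite dim_lker_coord0 /= subSnn.
move=> L; split => [LV|/subvP LK].
  apply/subvP => v vL; rewrite memv_ker coord0_eq0.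
  have := LV ((0, 0), tt) (conj erefl I) v vL.
  by rewrite /invariance_set /= !maxA add0r mxE => ->.
move=> [[x y] w] _ /= v /= /LK; rewrite memv_ker coord0_eq0 => /eqP v0.
by rewrite /invariance_set /= !maxA mxE v0 addr0.
Qed.

End two_rows.

Lemma additive_cost_metric (R : realType) (J : finType) (wt : J -> R) :
  (forall j, 0 < wt j) -> cost_metric (fun A : {set J} => \sum_(j in A) wt j).
Proof.
move=> wt0; have wt_ge0 j : 0 <= wt j by exact: ltW.
split.
- by move=> A; exact: sumr_ge0.
- move=> A B /finset.setIidPr AB; rewrite [leRHS](big_setID A)/= AB lerDl.
  exact: sumr_ge0.
- move=> A B j AB _ jB; rewrite !big_setU1//= ?addrK//.
  by apply: contra jB; exact: (fintype.subsetP AB).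
- by move=> j; rewrite big_set1.
Qed.

Lemma partition_set1 (T : finType) (D : {set T}) :
  finset.partition [set [set i]%SET | i in D] D.
Proof.
have [||+ _] := @indexed_partition T T D (fun i => [set i]%SET).
- by move=> i j _ _ ji; rewrite disjoints1 inE eq_sym.
- by move=> i _; rewrite -finset.card_gt0 cards1.
congr (is_true (finset.partition _ _)).
apply/finset.setP => x; rewrite cover_imset; apply/bigcupP/idP => [[i iD]|xD].
  by rewrite inE => /eqP ->.
by exists x; rewrite ?inE.
Qed.

(** The two costs as functions of the dimension [k + 1], with [lJ] and [l] the
    logarithms for the trivial and for the fine partition.  The part of rank
    [k + 1] has weight [q = (k + 1)^-1], so its term satisfies
    [(l + k) * q <= l + 1]: the denominator stays below [C * 2a * (2l + 1)],
    whereas the numerator is at least [C * a * k]. *)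
Lemma cost_ratio_ge (F : realFieldType) (C a lJ l k M : F) :
  0 < C -> 0 < a -> 0 <= lJ -> 0 < l -> 0 <= k -> 0 < M ->
  2 * M * (2 * l + 1) <= k ->
  M <= C * (a * (lJ + (k + 1) - 1) * (1 + (k + 1)^-1)) /
       (C * (2 * a * (l + 1 - 1) * 1 + 2 * a * (l + (k + 1) - 1) * (k + 1)^-1)).
Proof.
move=> C0 a0 lJ0 l0 k0 M0 Mk; set q := (k + 1)^-1.
have q0 : 0 < q by rewrite invr_gt0 ltr_wpDl.
have lkq : (l + k) * q <= l + 1 by rewrite ler_pdivrMr ?ltr_wpDl//; nra.
rewrite -mulf_div divff ?gt_eqF// mul1r.
have -> : 2 * a * (l + 1 - 1) * 1 + 2 * a * (l + (k + 1) - 1) * q =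
  a * (2 * (l + (l + k) * q)) by lra.
have -> : a * (lJ + (k + 1) - 1) * (1 + q) = a * ((lJ + k) * (1 + q)) by lra.
rewrite -mulf_div divff ?gt_eqF// mul1r ler_pdivlMr; last first.
  by rewrite mulr_gt0// addr_gt0// mulr_gt0// ltr_wpDr.
have kX : k <= (lJ + k) * (1 + q) by nra.
apply: le_trans kX; apply: le_trans Mk.
by rewrite mulrCA mulrA ler_pM2l ?mulr_gt0//; lra.
Qed.

Theorem proposition1 (R : realType) (eps beta : R)
    (heps : 0 < eps < 1) (hbeta : 0 < beta < 1) (M : R) (hM : 0 < M) :
  exists (I : ccp eps) (PP : {set {set 'I_(ccp_r I)}})
         (epss betas : {set 'I_(ccp_r I)} -> R) (nu : {set 'I_(ccp_r I)} -> R),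
    finset.partition PP [set: 'I_(ccp_r I)]%SET
    /\ (forall A, A \in PP -> 0 < epss A < 1)
    /\ (forall A, A \in PP -> 0 < betas A < 1)
    /\ \sum_(A in PP) epss A <= eps
    /\ \sum_(A in PP) betas A <= beta
    /\ cost_metric nu
    /\ M <= comp_cost nu [set [set: 'I_(ccp_r I)]]%SET (fun=> eps) (fun=> beta)
            / comp_cost nu PP epss betas.
Proof.
move: heps hbeta => /andP[eps0 eps1] /andP[beta0 beta1].
set l := ln (1 / (beta / 2)).
have l_gt0 : 0 < l.
  by rewrite ln_gt0// div1r invf_gt1 ?divr_gt0//; lra.
have lb_gt0 : 0 < ln (1 / beta) by rewrite ln_gt0// div1r invf_gt1.
(* The dimension is [n + 1]; this bound on [n] is what [cost_ratio_ge] needs. *)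
pose n := Num.bound (2 * M * (2 * l + 1)).
have n_ge : 2 * M * (2 * l + 1) <= n%:R.
  by apply/ltW/archi_boundP; nra.
pose wt (j : 'I_2) : R := if j == 0 then 1 else n.+1%:R^-1.
have sum_singletons (F : {set 'I_2} -> R) :
    \sum_(A in [set [set i]%SET | i in [set: 'I_2]%SET]) F A =
    F [set 0]%SET + F [set 1]%SET.
  rewrite big_imset/=; last by move=> i j _ _; exact: finset.set1_inj.
  rewrite (eq_bigl predT) => [|i]; last by rewrite inE.
  by rewrite big_ord_recl big_ord1; congr (_ + F [set _]%SET); exact: val_inj.
exists (two_row_ccp R eps n), [set [set i]%SET | i in [set: 'I_2]%SET],
  (fun=> eps / 2), (fun=> beta / 2), (fun A : {set 'I_2} => \sum_(j in A) wt j).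
split; first exact: partition_set1.
split; first by move=> _ _; lra.
split; first by move=> _ _; lra.
split; first by rewrite sum_singletons; lra.
split; first by rewrite sum_singletons; lra.
split.
  by apply: additive_cost_metric => j; rewrite /wt; case: ifP.
rewrite /comp_cost sum_singletons !big_set1 /= expr0 -/l.
rewrite support_rank_coord !support_rank_norm ?inE//.
rewrite (eq_bigl predT) => [|i]; last by rewrite inE.
rewrite big_ord_recl big_ord1 /wt/= -natr1 invf_div.
have C_gt0 : 0 < expR 1 / (expR 1 - 1) :> R.
  by rewrite divr_gt0 ?expR_gt0// subr_gt0 expR_gt1.
by apply: cost_ratio_ge; rewrite ?invr_gt0// ltW.
Qed.
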